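(* Let $\Gamma$ be a weighted digraph with Kirchhoff matrix $L$ and out forest dimension $v$, and let $\sigma_k$ be the total weight of all out forests of $\Gamma$ with $k$ arcs. Then $$p'_L(\lambda)=\lambda\sum_{i=0}^{n-v}\sigma_{n-v-i}\,(-\lambda)^{i}$$ is an annihilating polynomial for $L$, i.e. $p'_L(L)=0$.
   Context: $\Gamma$ is a weighted digraph without loops with vertex set $\{1,\dots,n\}$, $n>1$; all arcs have strictly positive real weights; $\varepsilon_{ij}$ denotes the weight of the arc from $i$ to $j$, with $\varepsilon_{ij}=0$ if and only if there is no such arc. The Kirchhoff matrix $L=(\ell_{ij})$ is the $n\times n$ matrix with $\ell_{ij}=-\varepsilon_{ji}$ for $j\ne i$ and $\ell_{ii}=-\sum_{k\ne i}\ell_{ik}$. A diverging forest is a digraph without (directed) circuits in which every vertex has indegree at most 1. An out forest of $\Gamma$ is a spanning subgraph of $\Gamma$ that is a diverging forest. The weight of a subgraph is the product of the weights of its arcs (1 if it has no arcs); the total weight of a set of subgraphs is the sum of the weights of its elements (0 for the empty set). The out forest dimension $v$ is the minimum number of weak components of an out forest of $\Gamma$, so the maximum number of arcs of an out forest is $n-v$. Here $p'_L$ is just the name of the polynomial (the prime does not denote a derivative). *)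

(* Defs.v *)
From HB Require Import structures.
From mathcomp Require Import all_boot all_order all_algebra.

Set Implicit Arguments.
Unset Strict Implicit.
Unset Printing Implicit Defensive.

Import Order.TTheory GRing.Theory Num.Theory.
Local Open Scope ring_scope.

Record wdigraph (R : realFieldType) (n : nat) := WDigraph {
  arcs : {set 'I_n * 'I_n};
  weight : 'I_n -> 'I_n -> R;
  arcs_loopless : forall i, (i, i) \notin arcs;
  weight_gt0 : forall i j, (i, j) \in arcs -> 0 < weight i j;
  weight_eq0 : forall i j, (i, j) \notin arcs -> weight i j = 0
}.

(* weight G i j is the weight of the arc from i to j, so the off-diagonal part
   is minus its transpose and every row sums to 0. *)
Definition kirchhoff (R : realFieldType) (n : nat) (G : wdigraph R n) :
    'M[R]_n :=
  \matrix_(i, j) if j != i then - weight G j i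
                 else - \sum_(k | k != i) - weight G k i.

(* A spanning subgraph is identified with its arc set F. *)
Section SpanningSubgraphs.
Variable n : nat.
Implicit Type F : {set 'I_n * 'I_n}.

Definition arc_rel F : rel 'I_n := fun i j => (i, j) \in F.

Definition indegree F (j : 'I_n) : nat := #|[set i | (i, j) \in F]|.

(* A circuit visits pairwise distinct vertices, so its length k.+1 is at
   most n. *)
Definition has_circuit F : bool :=
  [exists k : 'I_n, exists c : k.+1.-tuple 'I_n, ucycleb (arc_rel F) c].

Definition diverging_forest F : bool :=
  ~~ has_circuit F && [forall j, indegree F j <= 1]%N.

Definition weak_components F : nat :=
  n_comp (fun i j => arc_rel F i j || arc_rel F j i) 'I_n.

End SpanningSubgraphs.

Definition out_forest (R : realFieldType) (n : nat) (G : wdigraph R n)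
    (F : {set 'I_n * 'I_n}) : bool :=
  (F \subset arcs G) && diverging_forest F.

(* set0 is always an out forest (out_forest0), hence a valid witness. *)
Definition out_forest_dim (R : realFieldType) (n : nat) (G : wdigraph R n) :
    nat :=
  weak_components [arg min_(F < set0 | out_forest G F) weak_components F].

Definition subgraph_weight (R : realFieldType) (n : nat) (G : wdigraph R n)
    (F : {set 'I_n * 'I_n}) : R :=
  \prod_(a in F) weight G a.1 a.2.

Definition forest_weight (R : realFieldType) (n : nat) (G : wdigraph R n)
    (k : nat) : R :=
  \sum_(F | out_forest G F && (#|F| == k)) subgraph_weight G F.

Definition forest_poly (R : realFieldType) (n : nat) (G : wdigraph R n) :
    {poly R} :=
  let v := out_forest_dim G in
  'X * \sum_(0 <= i < (n - v).+1) forest_weight G (n - v - i) *: (- 'X) ^+ i.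

Lemma out_forest0 (R : realFieldType) (n : nat) (G : wdigraph R n) :
  out_forest G set0.
Proof.
rewrite /out_forest sub0set /=; apply/andP; split.
  apply/existsPn => k; apply/existsPn => c; apply/negP => /andP[].
  case: c => -[|x [|y s]] //= _; rewrite /arc_rel ?inE //=.
apply/forallP => j; rewrite /indegree (_ : [set i | _] = set0) ?cards0 //.
by apply/setP => i; rewrite !inE.
Qed.

Lemma out_forest_dimP (R : realFieldType) (n : nat) (G : wdigraph R n) :
  (exists2 F, out_forest G F & weak_components F = out_forest_dim G) /\
  (forall F, out_forest G F -> (out_forest_dim G <= weak_components F)%N).
Proof.
rewrite /out_forest_dim; case: arg_minnP => [|F oF minF].
  exact: out_forest0.
by split; first by exists F.
Qed.

Lemma out_forest_dim_le (R : realFieldType) (n : nat) (G : wdigraph R n) :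
  (out_forest_dim G <= n)%N.
Proof. by apply: leq_trans (max_card _) _; rewrite card_ord. Qed.

(* Main.v *)
(* Row i of X - L is X e_i - sum_k w(k,i) (e_i - e_k), so expanding det (X - L)
   by rows gives a sum over parent functions f : 'I_n -> option 'I_n, with
   det (1 - P_f) equal to 1 if f is acyclic and 0 otherwise; acyclic parent
   functions are the diverging forests, whence the matrix forest theorem
   char_poly L = sum_F (-1)^|F| w(F) X^(n - |F|). As |F| <= n - v, Cayley-Hamilton
   gives L^v Q(L) = 0, where p'_L = X Q. One factor L is enough because
   ker L^2 = ker L, which follows from a maximum principle for 1 + t L valid over
   any ordered field, archimedean or not. *)
Require Import Defs.
From mathcomp Require Import all_boot all_order all_algebra perm.
From mathcomp Require Import ring lra zify.
Import Order.TTheory GRing.Theory Num.Theory.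
Local Open Scope ring_scope.

(** * Diverging forests as acyclic parent functions *)

Section ParentFunctions.
Context {n : nat}.
Implicit Types (f : {ffun 'I_n -> option 'I_n}) (F : {set 'I_n * 'I_n}).

Definition acyclic F : bool :=
  [forall a in F, ~~ connect (arc_rel F) a.2 a.1].

(** Shortening the path that closes a circuit makes its vertices distinct, which also bounds its
    length by [n]. *)
Lemma has_circuitE F : has_circuit F = ~~ acyclic F.
Proof.
apply/idP/idP.
  case/existsP => k /existsP[[[|x s] //= sz]] /andP[cyc _].
  apply/forall_inPn; exists (last x s, x).
    by move: cyc; rewrite /cycle rcons_path => /andP[].
  rewrite negbK /=; apply/connectP; exists s => //.
  by move: cyc; rewrite /cycle rcons_path => /andP[].
case/forall_inPn => -[y x] yx; rewrite negbK /=.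
case/connectP => p pth yE; move: yE yx.
case/shortenP: pth => s pth us _ -> yx {p y}.
have ltsn : (size s < n)%N.
  by move/card_uniqP: us (max_card (mem (x :: s))) => ->; rewrite card_ord.
apply/existsP; exists (Ordinal ltsn); apply/existsP.
have szs : size (x :: s) == (size s).+1 by [].
exists (Tuple szs); rewrite /ucycleb us andbT.
by rewrite /cycle /= rcons_path pth.
Qed.

Definition parent_arcs f : {set 'I_n * 'I_n} := [set a | f a.2 == Some a.1].

Definition parent F : {ffun 'I_n -> option 'I_n} :=
  [ffun i => [pick j | (j, i) \in F]].

Lemma parent_arcsK f : parent (parent_arcs f) = f.
Proof.
apply/ffunP => i; rewrite ffunE; case: pickP => [j|nj].
  by rewrite inE /= => /eqP.
by case fi: (f i) => [j|] //; have := nj j; rewrite inE fi eqxx.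
Qed.

Lemma parentK {F} : [forall j, indegree F j <= 1]%N -> parent_arcs (parent F) = F.
Proof.
move/forallP => deg1; apply/setP => -[j i]; rewrite inE ffunE /=.
case: pickP => [k kF|->] //; apply/eqP/idP => [[<-] //|jF].
have /card_le1_eqP := deg1 i => /(_ j k).
by rewrite !inE => ->.
Qed.

Lemma diverging_forest_parent_arcs f :
  diverging_forest (parent_arcs f) = acyclic (parent_arcs f).
Proof.
rewrite /diverging_forest has_circuitE negbK; apply/andb_idr => _.
apply/forallP => j; apply/card_le1_eqP => x y; rewrite !inE /=.
by move=> /eqP-> /eqP[].
Qed.

Lemma big_parent_arcs (T : Type) (idx : T) (op : Monoid.com_law idx) f
    (g : 'I_n * 'I_n -> T) :
  \big[op/idx]_(a in parent_arcs f) g a =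
  \big[op/idx]_i (if f i is Some j then g (j, i) else idx).
Proof.
transitivity (\big[op/idx]_i \big[op/idx]_(j | f i == Some j) g (j, i)).
  rewrite (pair_big_dep xpredT (fun i j => f i == Some j)) /=.
  rewrite (reindex (fun p => (p.2, p.1))) /=; last first.
    by exists (fun p => (p.2, p.1)) => -[].
  by apply: eq_big => [[i j]|[i j] _] //=; rewrite inE.
apply: eq_bigr => i _; case: (f i) => [j|]; last by rewrite big_pred0.
by rewrite (big_pred1 j) // => k; rewrite eq_sym.
Qed.

Lemma card_parent_arcs f :
  (#|parent_arcs f| + #|[set i | f i == None]| = n)%N.
Proof.
rewrite -sum1_card big_parent_arcs -sum1dep_card [X in (_ + X)%N]big_mkcond /=.
rewrite -big_split /= -[RHS]card_ord -sum1_card.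
by apply: eq_bigr => i _; case: (f i).
Qed.

(** Ancestors of the tail are ancestors of the head, and acyclicity makes the head itself a new one.
    The number of ancestors thus serves as a depth. *)
Lemma acyclic_depth {F a} : acyclic F -> a \in F ->
  (#|[set r | connect (arc_rel F) r a.1]| <
   #|[set r | connect (arc_rel F) r a.2]|)%N.
Proof.
move=> /forall_inP acF aF; apply/proper_card/properP; split.
  apply/subsetP => r; rewrite !inE => /connect_trans-> //.
  by apply: connect1; rewrite /arc_rel -surjective_pairing.
by exists a.2; rewrite !inE ?connect0 // acF.
Qed.

Lemma det_parent (K : comNzRingType) f :
  \det (\matrix_(i, j) ((i == j)%:R - (f i == Some j)%:R) : 'M[K]_n) =
  (acyclic (parent_arcs f))%:R.
Proof.
set F := parent_arcs f; set M := \matrix_(i, j) _.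
have [acF|] := boolP (acyclic F).
  rewrite /determinant (bigD1 (1%g : 'S_n)) //= odd_perm1 mul1r big1 => [|i _].
    rewrite big1 ?addr0 // => s s1.
    (* A moved point i of s of least depth cannot have s i as its parent,
       since s i is moved as well. *)
    pose h i := #|[set r | connect (arc_rel F) r i]|.
    have [i0 si0] : exists i, s i != i.
      apply/existsP; rewrite -negb_forall; apply: contraNN s1 => /forallP s1.
      by apply/eqP/permP => i; rewrite perm1; apply/eqP.
    case: (@arg_minnP _ i0 (fun i => s i != i) h si0) => i si mini.
    rewrite (bigD1 i) //= mxE eq_sym (negPf si) sub0r.
    case: eqP => [fi|_]; last by rewrite oppr0 mul0r mulr0.
    have /(acyclic_depth acF)/= : (s i, i) \in F by rewrite inE /= fi.
    rewrite ltnNge => /negP[]; apply: mini.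
    by rewrite (inj_eq perm_inj).
  rewrite mxE perm1 eqxx; case: eqP => [fi|]; last by rewrite subr0.
  have /(acyclic_depth acF)/= : (i, i) \in F by rewrite inE /= fi.
  by rewrite ltnn.
case/forall_inPn => -[y x] yx; rewrite negbK /= => xy.
(* The set D of descendants of a vertex x on a circuit satisfies
   i \in D <-> parent of i \in D, so its indicator is in the kernel of M. *)
pose v : 'cV[K]_n := \col_i (connect (arc_rel F) x i)%:R.
have Mv : M *m v = 0.
  apply/colP => i; rewrite !mxE.
  under eq_bigr do rewrite !mxE mulrBl.
  rewrite sumrB (bigD1 i) //= eqxx mul1r big1 ?addr0; last first.
    by move=> j; rewrite eq_sym => /negPf->; rewrite mul0r.
  case fi: (f i) => [j|].
    rewrite (bigD1 j) //= eqxx mul1r big1 ?addr0; last first.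
      move=> k; rewrite eq_sym => kj.
      by rewrite (inj_eq (@Some_inj _)) (negPf kj) mul0r.
    suff -> : connect (arc_rel F) x i = connect (arc_rel F) x j by rewrite subrr.
    have ji : arc_rel F j i by rewrite /arc_rel inE /= fi.
    apply/idP/idP => [|/connect_trans-> //]; last exact: connect1.
    (* An empty path means [i = x], so [j] is [y], reachable by [xy]; otherwise the last arc of the
       path starts at [j]. *)
    case/connectP => p; case/lastP: p => [|p z] /=.
      by move=> _ ix; move: yx; rewrite inE /= -ix fi => /eqP[->]; rewrite ix.
    rewrite rcons_path last_rcons => /andP[pth lz] iz; move: lz.
    rewrite -iz /arc_rel inE /= fi => /eqP[->].
    by apply/connectP; exists p.
  rewrite big1 ?subr0; last by move=> k _; rewrite mul0r.
  case: connectP => // -[p]; case/lastP: p => [|p z] /=.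
    by move=> _ ix; move: yx; rewrite inE /= -ix fi.
  rewrite rcons_path last_rcons => /andP[_ lz] iz; move: lz.
  by rewrite -iz /arc_rel inE /= fi.
(* The adjugate gives [\det M *: v = 0], read off at [x], where [v] is 1; this is valid even with
   zero divisors. *)
have := congr1 (mulmx (\adj M)) Mv.
rewrite mulmxA mul_adj_mx mulmx0 mul_scalar_mx => /colP/(_ x).
by rewrite !mxE connect0 mulr1.
Qed.

(** Climbing to parents ends at a parentless vertex, so each weak component contains one, and there
    are [n - #|F|] of them in all. *)
Lemma weak_components_le {F} :
  diverging_forest F -> (weak_components F <= n - #|F|)%N.
Proof.
move=> dF; have /andP[_ /parentK FE] := dF.
rewrite -FE in dF *; move: (parent F) dF => f {F FE}.
rewrite diverging_forest_parent_arcs => acF.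
set F := parent_arcs f in acF *.
have -> : (n - #|F| = #|[set i | f i == None]|)%N.
  by rewrite -[X in (X - _)%N](card_parent_arcs f) addKn.
rewrite /weak_components /n_comp_mem.
set e := (fun i j => _).
have sym_e : connect_sym e by apply: sym_connect_sym => i j; rewrite /e orbC.
apply: leq_trans (leq_imset_card (fingraph.root e) _); apply/subset_leq_card.
apply/subsetP => r; rewrite !inE => /andP[/eqP rr _].
have [i fi ri] : exists2 i, f i == None & connect e r i.
  have [m] := ubnP #|[set k | connect (arc_rel F) k r]|.
  elim: m r {rr} => // m IH r; rewrite ltnS => hr.
  case fr: (f r) => [j|]; last by exists r; rewrite ?fr.
  have jr : (j, r) \in F by rewrite inE /= fr.
  have [i fi ji] := IH j (leq_trans (acyclic_depth acF jr) hr).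
  exists i => //; apply: connect_trans ji; apply: connect1.
  by rewrite /e {2}/arc_rel jr orbT.
apply/imsetP; exists i; first by rewrite inE.
by rewrite -[LHS]rr; apply/fingraph.rootP.
Qed.

(** Multilinearity in the rows: [f] picks one summand from each row. *)
Lemma det_sum_rows (K : comNzRingType) (I : finType) (c : 'I_n -> I -> K)
    (r : 'I_n -> I -> 'I_n -> K) :
  \det (\matrix_(i, j) \sum_o c i o * r i o j) =
  \sum_(f : {ffun 'I_n -> I})
    (\prod_i c i (f i)) * \det (\matrix_(i, j) r i (f i) j).
Proof.
rewrite /determinant.
under eq_bigr => s _.
  under eq_bigr do rewrite mxE.
  rewrite bigA_distr_bigA /= big_distrr /=.
  over.
rewrite exchange_big /=; apply: eq_bigr => f _.
rewrite big_distrr /=; apply: eq_bigr => s _.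
rewrite big_split /= mulrCA; do 2!congr (_ * _).
by apply: eq_bigr => i _; rewrite mxE.
Qed.

End ParentFunctions.

(** * The characteristic polynomial as a sum over forests *)

Section Kirchhoff.
Context {R : realFieldType} {n : nat}.
Variable G : wdigraph R n.

Lemma char_poly_kirchhoff_forests :
  char_poly (kirchhoff G) =
  \sum_(F | out_forest G F)
    (-1) ^+ #|F| * (subgraph_weight G F)%:P * 'X^(n - #|F|).
Proof.
(* [None] makes [i] a root and [Some k] gives it the parent [k]. The choice [k = i] is harmless
   because [r i (Some i)] vanishes. *)
pose c i o : {poly R} := if o is Some k then - (weight G k i)%:P else 'X.
pose r (i : 'I_n) o j : {poly R} := (i == j)%:R - (o == Some j)%:R.
have -> : char_poly (kirchhoff G) =
    \det (\matrix_(i, j) \sum_o c i o * r i o j).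
  congr (\det _); apply/matrixP => i j; rewrite !mxE.
  rewrite (bigD1 None) //= (reindex_omap Some id) => [|[]] //=.
  rewrite [in RHS](eq_bigl xpredT) => [|k]; last by rewrite eqxx.
  rewrite /r /= subr0 mulr_natr.
  congr (_ + _); under [RHS]eq_bigr do rewrite mulNr (inj_eq (@Some_inj _)).
  rewrite [in RHS]sumrN; congr (- _).
  have [->|ji] := eqVneq j i.
    rewrite /= sumrN opprK rmorph_sum [RHS](bigD1 i) //= eqxx subrr mulr0 add0r.
    by apply: eq_bigr => k /negPf->; rewrite subr0 mulr1.
  rewrite /= [RHS](bigD1 j) //= big1 => [|k /negPf->].
    by rewrite eqxx addr0 sub0r mulrN1 rmorphN.
  by rewrite subr0 mulr0.
rewrite det_sum_rows.
under eq_bigr do rewrite det_parent.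
(* A forest with an arc outside [arcs G] has weight 0, so the sum may run over all diverging
   forests. *)
rewrite [RHS](_ : _ = \sum_(F | diverging_forest F)
    (-1) ^+ #|F| * (subgraph_weight G F)%:P * 'X^(n - #|F|)); last first.
  rewrite [RHS](bigID (fun F : {set 'I_n * 'I_n} => F \subset arcs G)) /=.
  rewrite [X in _ + X]big1.
    by rewrite addr0; apply: eq_bigl => F; rewrite andbC.
  move=> F /andP[_ /subsetPn[a aF aG]]; rewrite /subgraph_weight (bigD1 a) //=.
  by rewrite weight_eq0 -?surjective_pairing // mul0r mulr0 mul0r.
rewrite (reindex_onto parent_arcs parent); last by move=> F /andP[_ /parentK].
rewrite [RHS]big_mkcond; apply: eq_bigr => f _.
rewrite parent_arcsK eqxx andbT diverging_forest_parent_arcs.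
case: (acyclic _); last by rewrite mulr0.
rewrite mulr1 -[X in 'X^(X - _)](card_parent_arcs f) addKn.
(* Sign, weight and power of X all split over the vertices: a vertex with a parent gives minus the
   arc weight, a root gives X. *)
rewrite /subgraph_weight rmorph_prod -prodr_const -big_split big_parent_arcs /=.
rewrite -prodr_const [X in _ * X]big_mkcond -big_split /=.
apply: eq_bigr => i _; rewrite inE; case: (f i) => [j|] /=.
  by rewrite mulr1 mulN1r.
by rewrite mul1r.
Qed.

Lemma card_out_forest_le {F} : out_forest G F -> (#|F| <= n - out_forest_dim G)%N.
Proof.
move=> oF; have /andP[_ /weak_components_le wF] := oF.
have [_ /(_ F oF) vF] := out_forest_dimP G.
have := leq_trans vF wF.
(* Subtraction is truncated, so [#|F| <= n] has to be secured separately; it holds because distinct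
   arcs have distinct heads. *)
have [|] := leqP #|F| n; first by lia.
have /andP[_ /andP[_ /parentK <-]] := oF.
by have := card_parent_arcs (parent F); lia.
Qed.

(** Forests are grouped by their number of arcs, at most [n - v], so that ['X^v] factors out. The
    extra ['X] on the left avoids the exponent [v - 1]. *)
Lemma char_poly_kirchhoff :
  let v := out_forest_dim G in
  'X * char_poly (kirchhoff G) = (-1) ^+ (n - v) * 'X^v * forest_poly G.
Proof.
move=> v; rewrite /forest_poly -/v mulrCA; congr (_ * _).
have vn : (v <= n)%N := out_forest_dim_le G.
(* Reversing the sum turns its index into the number of arcs. *)
rewrite char_poly_kirchhoff_forests big_nat_rev /= add0n big_mkord.
pose card F : 'I_(n - v).+1 := inord #|F : {set 'I_n * 'I_n}|.
rewrite (partition_big card xpredT) //=.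
rewrite big_distrr /=; apply: eq_bigr => k _.
have kv : (k <= n - v)%N by rewrite -ltnS.
rewrite subSS (subKn kv) /forest_weight scaler_suml !big_distrr /=.
apply: eq_big => F.
  apply: andb_id2l => oF.
  by rewrite -val_eqE /= inordK // ltnS card_out_forest_le.
move=> /andP[oF /eqP/(congr1 val)]; rewrite /= inordK; last first.
  by rewrite ltnS card_out_forest_le.
move=> ->; rewrite -mul_polyC.
have -> : (n - k = v + (n - v - k))%N by lia.
have -> : (- 'X) ^+ (n - v - k) =
    (-1) ^+ (n - v - k) * 'X^(n - v - k) :> {poly R}.
  by rewrite [LHS]exprNn.
rewrite -[X in _ = (-1) ^+ X * _ * _](subnKC kv) !exprD.
have : (-1) ^+ (n - v - k) * (-1) ^+ (n - v - k) = 1 :> {poly R}.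
  by rewrite -expr2 sqrr_sign.
move: ((-1) ^+ (n - v - k)) ((-1) ^+ k) => s s' ss.
rewrite -[LHS]mul1r -ss; move: (_%:P) 'X^v 'X^(n - v - k) => w a b.
ring.
Qed.

(** * The maximum principle and kernels of powers of the Kirchhoff matrix *)

Lemma mulmx_kirchhoff (z : 'cV[R]_n) i :
  (kirchhoff G *m z) i 0 = \sum_(k | k != i) weight G k i * (z i 0 - z k 0).
Proof.
rewrite mxE (bigD1 i) //= mxE eqxx /= sumrN opprK big_distrl -big_split /=.
by apply: eq_bigr => k ki; rewrite mxE ki mulNr mulrBr.
Qed.

Lemma weight_ge0 i j : 0 <= weight G i j.
Proof.
by have [/weight_gt0/ltW|/weight_eq0->] := boolP ((i, j) \in arcs G).
Qed.

(** At a vertex [m] where [z] is largest all differences [z m 0 - z k 0] are nonnegative, hence so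
    is the Kirchhoff term there. *)
Lemma kirchhoff_max_principle (t b : R) (z : 'cV[R]_n) :
  0 <= t -> (forall i, z i 0 + t * (kirchhoff G *m z) i 0 <= b) ->
  forall i, z i 0 <= b.
Proof.
move=> t0 zb i.
case: (@Order.TotalTheory.arg_maxP _ _ _ i xpredT (fun i => z i 0)) => // m _ zm.
apply: le_trans (zm i isT) _; apply: le_trans (zb m).
rewrite lerDl mulr_ge0 // mulmx_kirchhoff sumr_ge0 // => k _.
by rewrite mulr_ge0 ?weight_ge0 // subr_ge0; apply: zm.
Qed.

(* If y = L x and L y = 0, then (1 + t L) (x - t y) = x, so by the maximum
   principle x - t y stays below max x for every t >= 0, whence y >= 0. *)
Lemma kirchhoff_ker_ge0 (x : 'cV[R]_n) :
  kirchhoff G *m (kirchhoff G *m x) = 0 ->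
  forall i, 0 <= (kirchhoff G *m x) i 0.
Proof.
move yE: (kirchhoff G *m x) => y Ly i; rewrite leNgt; apply/negP => yi.
pose b : R := \sum_j `|x j 0|.
have xb j : `|x j 0| <= b by rewrite /b (bigD1 j) //= lerDl sumr_ge0.
(* Chosen so that entry [i] of [x - t *: y] is at least [- b + (2 * b + 1)], which exceeds [b]. *)
pose t : R := (2 * b + 1) / - y i 0.
have b0 : 0 <= b by rewrite sumr_ge0.
have t0 : 0 <= t by rewrite divr_ge0 ?oppr_ge0 ?ltW //; lra.
have := @kirchhoff_max_principle t b (x - t *: y) t0.
rewrite mulmxBr -scalemxAr Ly scaler0 subr0 yE => H.
have {H} := H _ i; rewrite !mxE => H.
have {H} : x i 0 - t * y i 0 <= b.
  by apply: H => j; rewrite !mxE subrK (le_trans (ler_norm _)).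
have -> : t * y i 0 = - (2 * b + 1).
  by rewrite /t invrN mulrN mulNr divfK // lt_eqF.
by have := xb i; rewrite ler_norml => /andP[]; lra.
Qed.

(** Nonnegativity is applied to each column of [A] and to its negative. *)
Lemma kirchhoff_ker_sqr m (A : 'M[R]_(n, m)) :
  kirchhoff G *m (kirchhoff G *m A) = 0 -> kirchhoff G *m A = 0.
Proof.
move=> LLA; apply/matrixP => i j; rewrite [RHS]mxE.
have LjA : kirchhoff G *m (kirchhoff G *m col j A) = 0.
  by rewrite colE !mulmxA -(mulmxA (kirchhoff G)) LLA mul0mx.
have -> : (kirchhoff G *m A) i j = (kirchhoff G *m col j A) i 0.
  by rewrite colE mulmxA -colE [RHS]mxE.
apply/le_anti; rewrite kirchhoff_ker_ge0 // andbT -oppr_ge0.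
have := @kirchhoff_ker_ge0 (- col j A); rewrite !mulmxN LjA oppr0.
by move=> /(_ erefl i); rewrite mxE.
Qed.

Lemma kirchhoff_ker_exp m k (A : 'M[R]_(n, m)) :
  iter k.+1 (mulmx (kirchhoff G)) A = 0 -> kirchhoff G *m A = 0.
Proof.
elim: k => //= k IH LLA; apply: IH.
exact: kirchhoff_ker_sqr.
Qed.

End Kirchhoff.

Theorem proposition10 (R : realFieldType) (n : nat) (G : wdigraph R n.+2) :
  horner_mx (kirchhoff G) (forest_poly G) = 0.
Proof.
set L := kirchhoff G; set v := out_forest_dim G.
have /(congr1 (horner_mx L)) := char_poly_kirchhoff G.
rewrite !rmorphM /= Cayley_Hamilton mulr0 -/v rmorphXn rmorphN1 horner_mx_X.
rewrite rmorphXn /= horner_mx_X -mulrA => /esym.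
move/(congr1 (fun A => (-1) ^+ (n.+2 - v) * A)).
rewrite mulr0 signrMK mulrA -exprSr.
(* [Q] is the value at [L] of the polynomial without its leading factor ['X]: [L ^+ v.+1 * Q = 0] is
   known and [L * Q = 0] is wanted. *)
set Q := horner_mx L _ => LQ.
apply: (@kirchhoff_ker_exp _ _ _ _ v).
have -> // : iter v.+1 (mulmx L) Q = L ^+ v.+1 * Q.
elim: v.+1 => [|k /= ->]; first by rewrite mul1r.
by rewrite exprS -mulrA.
Qed.
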